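(* Let $k\in(0,1)$ and let $(r_i)_{i\ge1}$ be a sequence of real numbers with $r_i\ge -1$ for all $i$ (the returns of successive trades). For $n\ge1$ let $R(n)=\prod_{i=1}^{n}(1-k)(1+r_i)$ be the cumulative return after $n$ trades with transaction cost rate $k$, and let $\bar r_n=\frac1n\sum_{i=1}^{n} r_i$. Then: (1) for every $n\ge 1$ with $\bar r_n\le k$, one has $R(n)\le 1$; (2) if $\bar r_n\le k$ for every $n\ge1$, then $\lim_{n\to+\infty}R(n)=0$.
   Context: A price series $S$ is given, with $S(t)$ the price at time $t$. The $i$-th trade buys at time $b_i$ and sells at time $s_i$, with $S(b_i)>0$ and $S(s_i)\ge 0$; its return is $r_i=\frac{S(s_i)-S(b_i)}{S(b_i)}$, so that $r_i\ge -1$. The transaction cost of the $i$-th trade is taken to be $T_i=k\,S(s_i)$, where the constant $k\in(0,1)$ is the transaction cost rate. The cumulative return after $n$ trades is $$R(n)=\prod_{i=1}^{n}\left(1+\frac{S(s_i)-S(b_i)-T_i}{S(b_i)}\right)=\prod_{i=1}^{n}(1-k)\frac{S(s_i)}{S(b_i)}=\prod_{i=1}^{n}(1-k)(1+r_i).$$ *)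

(* Defs.v *)
From mathcomp Require Import all_boot all_order all_algebra.
From mathcomp Require Import all_classical all_reals all_analysis.

Set Implicit Arguments.
Unset Strict Implicit.
Unset Printing Implicit Defensive.

Import Order.TTheory GRing.Theory Num.Theory.
Import numFieldNormedType.Exports.

Local Open Scope classical_set_scope.
Local Open Scope ring_scope.

(* Trades are numbered from 1: the value r 0 is never used. *)
Definition cumulative_return (R : realType) (k : R) (r : nat -> R) (n : nat) : R :=
  \prod_(1 <= i < n.+1) ((1 - k) * (1 + r i)).

(* Only meaningful for n >= 1. *)
Definition mean_return (R : realType) (r : nat -> R) (n : nat) : R :=
  n%:R^-1 * \sum_(1 <= i < n.+1) r i.

(* Main.v *)
(* AM-GM bounds R(n) by ((1 - k) (1 + mean))^n <= (1 - k^2)^n. *)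
Require Import Defs.
From mathcomp Require Import all_boot all_order all_algebra.
From mathcomp Require Import all_classical all_reals all_analysis.

Set Implicit Arguments.
Unset Strict Implicit.
Unset Printing Implicit Defensive.

Import Order.TTheory GRing.Theory Num.Theory.
Import numFieldNormedType.Exports.

Local Open Scope classical_set_scope.
Local Open Scope ring_scope.

(** Every factor [(1 - k) * (1 + r i)] is nonnegative, so AM-GM bounds their product by the [n]-th
    power of their mean ([cumulative_return_le_mean]). A mean return at most [k] makes that base at
    most (1 - k)(1 + k) = 1 - k^2, which lies in [0, 1) ([cumulative_return_le_geometric]). Its
    powers are at most 1 and tend to 0; the limit follows by squeezing. *)

Lemma cumulative_return_ge0 (R : realType) (k : R) (r : nat -> R) (n : nat) :
  k <= 1 -> (forall i : nat, (1 <= i)%N -> -1 <= r i) ->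
  0 <= cumulative_return k r n.
Proof.
move=> hk1 hr; rewrite /cumulative_return big_add1 big_mkord.
apply: prodr_ge0 => i _; apply: mulr_ge0; first by rewrite subr_ge0.
by rewrite -lerBlDl sub0r hr.
Qed.

(** AM-GM: by linearity, the arithmetic mean of the factors is the base on the right. *)
Lemma cumulative_return_le_mean (R : realType) (k : R) (r : nat -> R) (n : nat) :
  k <= 1 -> (forall i : nat, (1 <= i)%N -> -1 <= r i) -> (1 <= n)%N ->
  cumulative_return k r n <= ((1 - k) * (1 + mean_return r n)) ^+ n.
Proof.
move=> hk1 hr n_gt0.
have n_neq0 : n%:R != 0 :> R by rewrite pnatr_eq0 -lt0n.
have factor_ge0 (i : 'I_n) : i \in 'I_n -> 0 <= (1 - k) * (1 + r i.+1).
  move=> _; apply: mulr_ge0; first by rewrite subr_ge0.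
  by rewrite -lerBlDl sub0r hr.
have := leif_AGM factor_ge0.
rewrite card_ord => -[AGM _].
rewrite /cumulative_return /mean_return !big_add1 !big_mkord /=.
apply: (le_trans AGM); rewrite -mulr_sumr big_split /= sumr_const card_ord.
have -> : 1 + n%:R^-1 * (\sum_(i < n) r i.+1) = (n%:R + \sum_(i < n) r i.+1) / n%:R.
  by rewrite mulrDl divff // mulrC.
by rewrite mulrA.
Qed.

Lemma cumulative_return_le_geometric (R : realType) (k : R) (r : nat -> R)
    (n : nat) :
  k <= 1 -> (forall i : nat, (1 <= i)%N -> -1 <= r i) -> (1 <= n)%N ->
  mean_return r n <= k -> cumulative_return k r n <= (1 - k ^+ 2) ^+ n.
Proof.
move=> hk1 hr n_gt0 mean_le.
apply: le_trans (cumulative_return_le_mean hk1 hr n_gt0) _.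
(* Raising to the power [n] is monotone on nonnegative bases; this bound makes [1 + mean_return r n]
   nonnegative. *)
have mean_ge : -1 <= mean_return r n.
  rewrite /mean_return big_add1 big_mkord /= mulrC ler_pdivlMr ?ltr0n //.
  rewrite mulN1r -[X in - X%:R]card_ord -sumr_const -sumrN.
  by apply: ler_sum => i _; apply: hr.
rewrite lerXn2r ?nnegrE //.
- by rewrite mulr_ge0 ?subr_ge0 // -lerBlDl sub0r.
(* The factor [1 + k] is nonnegative because [-1 <= mean_return r n <= k]. *)
- rewrite -[1 in leRHS](expr1n _ 2) subr_sqr mulr_ge0 ?subr_ge0 //.
  by rewrite -lerBlDl sub0r (le_trans mean_ge).
- rewrite -[1 in leRHS](expr1n _ 2) subr_sqr.
  by rewrite ler_wpM2l ?subr_ge0 // lerD2l.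
Qed.

Theorem proposition1 (R : realType) (k : R) (r : nat -> R)
    (hk0 : 0 < k) (hk1 : k < 1)
    (hr : forall i : nat, (1 <= i)%N -> -1 <= r i) :
  (forall n : nat, (1 <= n)%N ->
     mean_return r n <= k -> cumulative_return k r n <= 1) /\
  ((forall n : nat, (1 <= n)%N -> mean_return r n <= k) ->
     cumulative_return k r n @[n --> \oo] --> (0 : R)).
Proof.
have hk1' := ltW hk1.
have q_ge0 : 0 <= 1 - k ^+ 2 by rewrite subr_ge0 exprn_ile1 // ltW.
(* Strictness comes from [0 < k] and makes the geometric bound vanish in the limit. *)
have q_lt1 : 1 - k ^+ 2 < 1 by rewrite gtrBl exprn_gt0.
split=> [n n_gt0 mean_le|mean_le].
  apply: le_trans (cumulative_return_le_geometric hk1' hr n_gt0 mean_le) _.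
  by rewrite exprn_ile1 // ltW.
apply: (@squeeze_cvgr _ _ _ _ (fun=> 0) (fun n => (1 - k ^+ 2) ^+ n)).
(* The upper bound is available only for [n >= 1], so the squeeze is stated eventually. *)
- near=> n; rewrite cumulative_return_ge0 //=.
  have n_gt0 : (1 <= n)%N by near: n; exact: nbhs_infty_ge.
  exact: cumulative_return_le_geometric (mean_le _ n_gt0).
- exact: cvg_cst.
- by apply: cvg_expr; rewrite ger0_norm.
Unshelve. all: by end_near.
Qed.
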